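(* Assume the axiom of determinacy $\mathsf{AD}$. Let $d\ge1$ be an integer, let $A\subseteq\mathbb{R}^d$ and let $0\le\delta\le d$. Then either $A$ contains a compact set $K$ with $\mathrm{HD}(K)\ge\delta$, or $\mathrm{HD}(A)\le\delta$.
   Context: $\mathrm{HD}$ denotes Hausdorff dimension, defined for arbitrary subsets of $\mathbb{R}^d$ and satisfying $0\le\mathrm{HD}(A)\le d$ for all $A\subseteq\mathbb{R}^d$. $\mathsf{AD}$ is the statement that every two-player perfect-information game of length $\omega$ on $\omega=\mathbb{N}$ is determined. As $\mathsf{AD}$ contradicts the full axiom of choice, the result is understood over $\mathsf{ZF}$ without the full axiom of choice. *)

(* Defs.v *)
From Stdlib Require Import Reals List.
From mathcomp Require Import ssreflect ssrfun ssrbool eqtype fintype bigop.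
From Coquelicot Require Import Coquelicot.

Set Implicit Arguments.
Unset Strict Implicit.
Unset Printing Implicit Defensive.

Open Scope R_scope.

(** [AD] below is refutable from the axiom of choice, so everything here is set
    up on the reals of the standard library, which rest on excluded middle,
    function extensionality and countable search ([sig_forall_dec]) but on no
    choice principle: the ambient theory plays the role of ZF without choice. *)

(** * Determinacy *)

(** [prefix x n] is the finite sequence [x 0, ..., x (n - 1)]. *)
Definition prefix (x : nat -> nat) (n : nat) : list nat :=
  List.map x (List.seq 0 n).

(** A strategy reads the whole position (the finite sequence of all the moves
    made so far by both players).  Player I makes the moves of even index and
    player II those of odd index. *)
Definition strategy : Type := list nat -> nat.

Definition follows_I (sigma : strategy) (x : nat -> nat) : Prop :=
  forall n : nat, x (2 * n)%nat = sigma (prefix x (2 * n)%nat).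

Definition follows_II (tau : strategy) (x : nat -> nat) : Prop :=
  forall n : nat, x (2 * n + 1)%nat = tau (prefix x (2 * n + 1)%nat).

Definition winning_I (P : (nat -> nat) -> Prop) (sigma : strategy) : Prop :=
  forall x : nat -> nat, follows_I sigma x -> P x.

Definition winning_II (P : (nat -> nat) -> Prop) (tau : strategy) : Prop :=
  forall x : nat -> nat, follows_II tau x -> ~ P x.

Definition determined (P : (nat -> nat) -> Prop) : Prop :=
  (exists sigma : strategy, winning_I P sigma) \/
  (exists tau : strategy, winning_II P tau).

Definition AD : Prop := forall P : (nat -> nat) -> Prop, determined P.

(** * Euclidean space *)

Definition point (d : nat) : Type := 'I_d -> R.

Definition dist_euc (d : nat) (x y : point d) : R :=
  sqrt (\big[Rplus/0]_(i < d) (x i - y i) ^ 2).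

Definition subset (d : nat) (A B : point d -> Prop) : Prop :=
  forall x : point d, A x -> B x.

Definition open_set (d : nat) (U : point d -> Prop) : Prop :=
  forall x : point d, U x ->
    exists r : R, 0 < r /\ forall y : point d, dist_euc x y < r -> U y.

Definition compact_set (d : nat) (K : point d -> Prop) : Prop :=
  forall C : (point d -> Prop) -> Prop,
    (forall U, C U -> open_set U) ->
    (forall x, K x -> exists U, C U /\ U x) ->
    exists l : list (point d -> Prop),
      (forall U, List.In U l -> C U) /\
      (forall x, K x -> exists U, List.In U l /\ U x).

(** * Hausdorff measures and Hausdorff dimension *)

(** The supremum is taken in the extended reals: the diameter of an unbounded
    set is [p_infty], and that of the empty set is [m_infty]. *)
Definition diam (d : nat) (U : point d -> Prop) : Rbar :=
  Lub_Rbar (fun r => exists x y : point d, U x /\ U y /\ r = dist_euc x y).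

(** [diam(U)^s] with the usual conventions: the empty set contributes [0], and
    [0^0 = 1] for a nonempty set.  [Rpower] is only meaningful on positive bases
    ([Rpower 0 s] is [1]), hence the case distinction.  The value at an unbounded
    set is irrelevant, as the members of the covers below are bounded. *)
Definition diam_pow (d : nat) (s : R) (U : point d -> Prop) : R :=
  match diam U with
  | Finite r =>
      if Rlt_dec 0 r then Rpower r s else if Req_EM_T s 0 then 1 else 0
  | _ => 0
  end.

(** Finite covers are included, since members of the sequence may be empty. *)
Definition is_cover (d : nat) (eps : R) (A : point d -> Prop)
    (U : nat -> point d -> Prop) : Prop :=
  (forall i : nat, Rbar_le (diam (U i)) eps) /\
  (forall x : point d, A x -> exists i : nat, U i x).

(** Covers with a divergent sum do not affect the infimum, which is [p_infty]
    when there is no other cover. *)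
Definition hausdorff_premeasure (d : nat) (s eps : R) (A : point d -> Prop)
    : Rbar :=
  Glb_Rbar (fun t => exists U : nat -> point d -> Prop,
    is_cover eps A U /\ is_series (fun i => diam_pow s (U i)) t).

Definition hausdorff_measure (d : nat) (s : R) (A : point d -> Prop) : Rbar :=
  Rbar_lub (fun h => exists eps : R, 0 < eps /\ h = hausdorff_premeasure s eps A).

Definition HD (d : nat) (A : point d -> Prop) : Rbar :=
  Glb_Rbar (fun s => 0 <= s /\ hausdorff_measure s A = Finite 0).

(* Main.v *)
From Stdlib Require Import Reals Lra Lia Classical ConstructiveEpsilon.
From Stdlib Require Import ClassicalDedekindReals.
From HB Require Import structures.
From mathcomp Require Import all_boot.
From Coquelicot Require Import Coquelicot.
Require Import Defs.

(** Fix [s > delta]. It suffices to find either a compact subset of [A] of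
    dimension at least [delta], or covers showing that [A] is null for the
    [s]-dimensional Hausdorff measure. A game decides between the two.

    Subdivide a cube repeatedly into [B ^ d] subcubes, where [B] is a large base.
    In each round the first player offers a set of subcubes of the current cube
    and the second player selects one of them ([payoff]). The first player wins
    if the selected cubes shrink to a point of [A] and, for every [m], the product
    of the sizes of the first [m] offers is at least [c * B ^ (delta * m)]. So
    that all of the space is reached and [c] is as small as needed, the first
    player also begins by naming [k], on which the initial cube, of side [k + 1],
    and the constant [c] depend.

    A winning strategy of the first player is a tree of cubes all of whose
    branches end in [A]. Offers are finite, so by the fan theorem ([fan]) the set
    of these points is compact. Sharing mass equally among the members of each
    offer gives a cube of level [m] mass at most [B ^ (- delta * m) / c], and the
    mass distribution principle bounds the dimension from below
    ([compact_of_tree]).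

    Let the second player have a winning strategy. In a given position, offer all
    [N = B ^ d] subcubes, remove the one that is selected, offer the rest, and so
    on: this ranks the subcubes, each one being selected from an offer of its own
    size between [1] and [N] ([offer_selects], [sum_inv_card_offer]). Against
    these offers the first player can steer the play to any point [y] of [A] in
    the initial cube, and loses; hence at some level [m] the product of the ranks
    along the address of [y] is less than [c * B ^ (delta * m)]. Give a cube the
    product of its inverse ranks as weight. The weights at level [m] sum to
    [(1 + 1/2 + ... + 1/N) ^ m], and the cubes just found have weight more than
    [B ^ (- delta * m) / c], so they are few. As the harmonic sum is logarithmic
    in [B], its contribution to the exponent is below [s - delta] once [B] is
    large ([exists_base]), and the [s]-th powers of the diameters of these cubes,
    over all [m], have a sum of order [2 ^ - k] ([null_of_rejected]).

    No choice is used. One strategy serves all initial cubes at once, because [k]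
    is a move of the game, and the covers are explicit in that strategy. *)

Set Implicit Arguments.
Unset Strict Implicit.
Unset Printing Implicit Defensive.
Open Scope R_scope.

Local Notation "\rsum_ ( i <- r ) F" := (\big[Rplus/0]_(i <- r) F)
  (at level 41, F at level 41, i, r at level 50,
   format "\rsum_ ( i  <-  r )  F").
Local Notation "\rsum_ ( i 'in' A ) F" := (\big[Rplus/0]_(i in A) F)
  (at level 41, F at level 41, i, A at level 50,
   format "\rsum_ ( i  'in'  A )  F").
Local Notation "\rsum_ ( i < n ) F" := (\big[Rplus/0]_(i < n) F)
  (at level 41, F at level 41, i, n at level 50,
   format "\rsum_ ( i  <  n )  F").

HB.instance Definition _ := Monoid.isComLaw.Build R 0 Rplus
  (fun x y z => esym (Rplus_assoc x y z)) Rplus_comm Rplus_0_l.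
HB.instance Definition _ := Monoid.isMulLaw.Build R 0 Rmult
  Rmult_0_l Rmult_0_r.
HB.instance Definition _ := Monoid.isAddLaw.Build R Rmult Rplus
  Rmult_plus_distr_r Rmult_plus_distr_l.

(** * Deciding propositions and choosing natural numbers *)

(** Only least natural numbers and elements of finite types are ever extracted
    from such decisions, so that no choice principle enters the argument. *)
Definition decide (P : Prop) : {P} + {~ P} :=
  match sig_not_dec P with
  | left nnP => left (NNPP P nnP)
  | right nP => right nP
  end.

Definition holds (P : Prop) : bool := decide P.

Lemma holdsP P : reflect P (holds P).
Proof. by rewrite /holds; case: decide => h; constructor. Qed.

Lemma nat_choice (P : nat -> nat -> Prop) :
  (forall i, exists m, P i m) -> exists f : nat -> nat, forall i, P i (f i).
Proof.
move=> H.
exists (fun i => proj1_sig (constructive_indefinite_ground_description_nat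
                   _ (fun m => decide (P i m)) (H i))).
by move=> i; case: constructive_indefinite_ground_description_nat.
Qed.

Lemma INR_addn (m n : nat) : INR (m + n)%N = INR m + INR n.
Proof. exact: plus_INR. Qed.

Lemma INR_muln (m n : nat) : INR (m * n)%N = INR m * INR n.
Proof. exact: mult_INR. Qed.

(** * Finite sums of reals *)

Section Sums.
Variables (I : Type) (r : seq I).
Implicit Types F G : I -> R.

Lemma rsum_le (P : pred I) F G :
  (forall i, P i -> F i <= G i) ->
  \big[Rplus/0]_(i <- r | P i) F i <= \big[Rplus/0]_(i <- r | P i) G i.
Proof.
move=> H; elim/big_ind2: _ => //; first lra.
by move=> *; lra.
Qed.

Lemma rsum_ge0 (P : pred I) F :
  (forall i, P i -> 0 <= F i) -> 0 <= \big[Rplus/0]_(i <- r | P i) F i.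
Proof.
move=> H; elim/big_ind: _ => //; first lra.
by move=> *; lra.
Qed.

Lemma rsum_const (x : R) : \rsum_(i <- r) x = INR (size r) * x.
Proof.
elim: r => [|a s IH]; first by rewrite big_nil /=; lra.
rewrite big_cons IH; change (size (a :: s)) with (size s).+1.
by rewrite S_INR; lra.
Qed.

End Sums.

Arguments rsum_le {I r P F G}.

Lemma rsum_subset (T : eqType) (r1 r2 : seq T) (F : T -> R) :
  uniq r1 -> {subset r1 <= r2} -> (forall x, 0 <= F x) ->
  \rsum_(x <- r1) F x <= \rsum_(x <- r2) F x.
Proof.
move=> + + F0; elim: r1 r2 => [|x r1 IH] r2 /=.
  by move=> _ _; rewrite big_nil; apply: rsum_ge0.
move=> /andP[xr1 u1] sub.
have xr2 : x \in r2 by apply: sub; rewrite inE eqxx.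
rewrite big_cons (perm_big _ (perm_to_rem xr2)) big_cons /=.
apply: Rplus_le_compat_l; apply: IH => // y yr1.
have : y \in x :: rem x r2.
  by rewrite -(perm_mem (perm_to_rem xr2)); apply: sub; rewrite inE yr1 orbT.
by rewrite inE => /orP[/eqP E|//]; rewrite -E yr1 in xr1.
Qed.

Lemma rsum_geom_le (x : R) (n : nat) :
  0 <= x <= / 2 -> \rsum_(i < n) x ^ i <= 2.
Proof.
move=> x0.
suff: \rsum_(i < n) x ^ i <= 2 - 2 * x ^ n.
  by have := pow_le x n (proj1 x0); lra.
elim: n => [|n IH]; first by rewrite big_ord0 /=; lra.
rewrite big_ord_recr; apply: Rle_trans (Rplus_le_compat_r _ _ _ IH) _ => /=.
have xn : 0 <= (/ 2 - x) * x ^ n.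
  by apply: Rmult_le_pos; [lra | apply: pow_le; lra].
lra.
Qed.

(** The head is zeroed rather than reindexed away: the cover built below is
    indexed by all the scales [k], and the early ones contribute empty sets. *)
Lemma rsum_half_tail_le (k0 n : nat) :
  \rsum_(k < n) (if (k0 <= k)%N then (/ 2) ^ k else 0) <= 2 * (/ 2) ^ k0.
Proof.
suff: \rsum_(k < n) (if (k0 <= k)%N then (/ 2) ^ k else 0)
        <= 2 * (/ 2) ^ k0 - 2 * (/ 2) ^ maxn k0 n.
  have : 0 < (/ 2) ^ maxn k0 n by apply: pow_lt; lra.
  by lra.
elim: n => [|n IH]; first by rewrite big_ord0 maxn0; lra.
rewrite big_ord_recr; apply: Rle_trans (Rplus_le_compat_r _ _ _ IH) _ => /=.
case: (leqP k0 n) => kn; first by rewrite (maxn_idPr (leqW kn)) /=; lra.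
by rewrite (maxn_idPl kn); lra.
Qed.

Lemma sum_n_rsum (a : nat -> R) n : sum_n a n = \rsum_(i < n.+1) a i.
Proof.
elim: n => [|n IH]; first by rewrite sum_O big_ord_recr big_ord0 /=; lra.
by rewrite sum_Sn IH [RHS]big_ord_recr.
Qed.

Lemma series_ge_partial (a : nat -> R) t n :
  (forall i, 0 <= a i) -> is_series a t -> \rsum_(i < n) a i <= t.
Proof.
move=> a0 st.
apply: (@Rle_trans _ (sum_n a n)).
  by rewrite sum_n_rsum big_ord_recr /=; have := a0 n; lra.
apply: (@is_lim_seq_incr_compare (sum_n a) t st _ n) => m.
by rewrite sum_Sn /plus /=; have := a0 m.+1; lra.
Qed.

Lemma series_le_bound (a : nat -> R) (B : R) :
  (forall i, 0 <= a i) -> (forall n, \rsum_(i < n) a i <= B) ->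
  exists t, t <= B /\ is_series a t.
Proof.
move=> a0 aB.
have aB' n : sum_n a n <= B by rewrite sum_n_rsum.
have [|t lt] := ex_finite_lim_seq_incr (sum_n a) B _ aB'.
  by move=> m; rewrite sum_Sn /plus /=; have := a0 m.+1; lra.
exists t; split=> //.
by apply: (is_lim_seq_le _ _ _ _ aB' lt (is_lim_seq_const B)).
Qed.

(** * Nodes of the address tree *)

Section Tree.
Variable D : finType.
Implicit Types (q : seq D) (a : nat -> D).

Fixpoint level (m : nat) : seq (seq D) :=
  if m is m'.+1 then [seq rcons q x | q <- level m', x <- enum D]
  else [:: [::]].

Lemma mem_level m q : (q \in level m) = (size q == m).
Proof.
elim: m q => [|m IH] q; first by rewrite inE; case: q.
apply/allpairsP/idP => [[[p x] /= [pm _ ->]]|].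
  by rewrite size_rcons eqSS -IH.
case/lastP: q => [|p x] //; rewrite size_rcons eqSS -IH => pm.
by exists (p, x); rewrite mem_enum.
Qed.

Lemma uniq_level m : uniq (level m).
Proof.
elim: m => [|m IH] //=.
apply: allpairs_uniq => //; first exact: enum_uniq.
by move=> [p x] [p' x'] _ _ /= /rcons_inj [-> ->].
Qed.

Lemma rsum_levelS m (F : seq D -> R) :
  \rsum_(q <- level m.+1) F q
  = \rsum_(q <- level m) \big[Rplus/0]_(x : D) F (rcons q x).
Proof.
rewrite /= big_allpairs_dep; apply: eq_bigr => q _.
by rewrite big_enum.
Qed.

(** With [p q x] the probability of the child [x] of [q], this is the mass of
    the cylinder above a node; with [p q x] the size of the set from which [x]
    was selected at [q], it is what the score of a play is compared with. *)
Fixpoint nodeprod (p : seq D -> D -> R) (q : seq D) : R :=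
  if q is x :: q' then p [::] x * nodeprod (fun q => p (x :: q)) q' else 1.

Lemma nodeprod_rcons p q x :
  nodeprod p (rcons q x) = nodeprod p q * p q x.
Proof.
elim: q p => [|y q IH] p /=; first lra.
by rewrite IH; lra.
Qed.

Lemma nodeprod_ge0 p q : (forall q x, 0 <= p q x) -> 0 <= nodeprod p q.
Proof.
move=> p0; elim/last_ind: q => [|q x IH]; first by rewrite /=; lra.
by rewrite nodeprod_rcons; apply: Rmult_le_pos.
Qed.

Lemma rsum_level_nodeprod_le p (L : R) m :
  (forall q x, 0 <= p q x) ->
  (forall q, \big[Rplus/0]_(x : D) p q x <= L) ->
  \rsum_(q <- level m) nodeprod p q <= L ^ m.
Proof.
move=> p0 pL.
have L0 : 0 <= L by apply: Rle_trans (pL [::]); apply: rsum_ge0.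
elim: m => [|m IH]; first by rewrite big_seq1 /=; lra.
rewrite rsum_levelS /= Rmult_comm.
apply: Rle_trans (Rmult_le_compat_r _ _ _ L0 IH).
rewrite big_distrl /=; apply: rsum_le => q _.
under eq_bigr do rewrite nodeprod_rcons.
rewrite -big_distrr /=; apply: Rmult_le_compat_l => //.
exact: nodeprod_ge0.
Qed.

(** Each node splits its mass among its children, so the mass of an event
    decided at level [m] can be computed at any finer level. *)
Lemma rsum_level_marginal p (f : seq D -> R) m n :
  (forall q, \big[Rplus/0]_(x : D) p q x = 1) ->
  \rsum_(q <- level (m + n)) (f (take m q) * nodeprod p q)
  = \rsum_(q <- level m) (f q * nodeprod p q).
Proof.
move=> p1; elim: n => [|n IH].
  rewrite addn0; apply: eq_big_seq => q.
  by rewrite mem_level => /eqP <-; rewrite take_size.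
rewrite addnS rsum_levelS -IH; apply: eq_big_seq => q.
rewrite mem_level => /eqP sq.
under eq_bigr => x _.
  rewrite nodeprod_rcons -cats1 takel_cat ?sq ?leq_addr // -Rmult_assoc.
  over.
by rewrite -big_distrr /= p1 Rmult_1_r.
Qed.

(** * Branches *)

Definition node (next : seq D -> D) (m : nat) : seq D :=
  iter m (fun q => rcons q (next q)) [::].

Definition branch (next : seq D -> D) (j : nat) : D := next (node next j).

Lemma mkseq_branch next m : mkseq (branch next) m = node next m.
Proof. by elim: m => [|m IH] //; rewrite mkseqS IH. Qed.

Definition legal_branch (S : seq D -> {set D}) a : Prop :=
  forall j, a j \in S (mkseq a j).

Definition legal (S : seq D -> {set D}) q : Prop :=
  forall q' x q'', q = q' ++ x :: q'' -> x \in S q'.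

Lemma legal_rcons S q x : legal S q -> x \in S q -> legal S (rcons q x).
Proof.
move=> lq xq q1 y q2; case/lastP: q2 => [|q2 z] E.
  by move: E; rewrite cats1 => /rcons_inj [<- <-].
apply: (lq q1 y q2).
by move: E; rewrite -rcons_cons -rcons_cat => /rcons_inj [].
Qed.

Lemma legal_mkseq S a m : legal_branch S a -> legal S (mkseq a m).
Proof.
move=> la; elim: m => [|m IH]; first by case.
by rewrite mkseqS; apply: legal_rcons.
Qed.

Lemma take_mkseq a m n : (m <= n)%N -> take m (mkseq a n) = mkseq a m.
Proof. by move=> mn; rewrite /mkseq -map_take take_iota (minn_idPl mn). Qed.

Lemma uniform_bound (T : eqType) (r : seq T) (P : T -> nat -> Prop) :
  (forall x m n, P x m -> (m <= n)%N -> P x n) ->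
  (forall x, x \in r -> exists m, P x m) ->
  exists m, forall x, x \in r -> P x m.
Proof.
move=> mono; elim: r => [|x r IH] H; first by exists 0%N.
have [m Pm] := IH (fun y yr => H y (@mem_behead _ (x :: r) y yr)).
have [n Pn] := H x (mem_head x r).
exists (maxn m n) => y; rewrite inE => /orP[/eqP ->|yr].
  exact: mono Pn (leq_maxr _ _).
exact: mono (Pm y yr) (leq_maxl _ _).
Qed.

(** If the root is not secured at any depth, then neither is one of its finitely
    many children, and so on along a branch, which no bar can then meet. *)
Lemma fan (S : seq D -> {set D}) (bar : seq D -> Prop) :
  (forall a, legal_branch S a -> exists m, bar (mkseq a m)) ->
  exists M, forall q, legal S q -> size q = M ->
    exists2 m, (m <= M)%N & bar (take m q).
Proof.
move=> hbar.
pose secured q M := forall q', legal S (q ++ q') -> size q' = M ->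
  exists2 m, (m <= size q + M)%N & bar (take m (q ++ q')).
case: (classic (exists M, secured [::] M)) => [[M sM]|nsec].
  by exists M => q lq sq; apply: sM.
have mono q m n : secured q m -> (m <= n)%N -> secured q n.
  move=> sm mn q' lq' sq'.
  have sq'm : size (take m q') = m by rewrite size_takel // sq'.
  have l' : legal S (q ++ take m q').
    move=> p x p' E; apply: (lq' p x (p' ++ drop m q')).
    by rewrite -{1}(cat_take_drop m q') catA E -catA.
  have [k kq bk] := sm _ l' sq'm.
  exists k; first by rewrite (leq_trans kq) // leq_add2l.
  rewrite -(cat_take_drop m q') catA takel_cat //.
  by rewrite size_cat sq'm.
have step q : ~ (exists M, secured q M) ->
    exists x, x \in S q /\ ~ (exists M, secured (rcons q x) M).
  move=> ns; apply: NNPP => nx; apply: ns.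
  have [||M HM] := @uniform_bound _ (enum (S q))
    (fun x M => secured (rcons q x) M).
  - by move=> x m n; apply: mono.
  - move=> x; rewrite mem_enum => xq; apply: NNPP => nM; apply: nx.
    by exists x.
  exists M.+1 => -[|x q'] // lq' [sq'].
  have xq : x \in S q by apply: (lq' q x q').
  have := HM x _ q'; rewrite mem_enum xq cat_rcons size_rcons addSnnS.
  by apply.
case: (classic (exists x0 : D, True)) => [[x0 _]|D0]; last first.
  have [x _] : exists x, x \in S [::] /\ ~ (exists M, secured (rcons [::] x) M).
    exact: step nsec.
  by case: D0; exists x.
pose next q := odflt x0
  [pick x | holds (x \in S q /\ ~ (exists M, secured (rcons q x) M))].
have nextP q : ~ (exists M, secured q M) ->
    next q \in S q /\ ~ (exists M, secured (rcons q (next q)) M).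
  move=> /step [x hx]; rewrite /next.
  by case: pickP => [y /holdsP|/(_ x) /holdsP].
have nodeP m : ~ (exists M, secured (node next m) M).
  by elim: m => [|m /nextP []].
have [|m bm] := hbar (branch next).
  by move=> j; rewrite mkseq_branch; case: (nextP _ (nodeP j)).
case: (nodeP m); exists 0%N => -[|//] _ _; rewrite cats0 addn0.
exists m; first by rewrite -mkseq_branch size_mkseq.
by rewrite take_oversize -mkseq_branch // size_mkseq.
Qed.

End Tree.
(** * Distances, diameters and Hausdorff measures *)

Section Euclidean.
Variable d : nat.
Implicit Types (x y : point d) (U : point d -> Prop).

Lemma coord_le_dist x y i : Rabs (x i - y i) <= dist_euc x y.
Proof.
rewrite -sqrt_Rsqr_abs /dist_euc; apply: sqrt_le_1_alt.
rewrite (bigD1 i) //.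
apply: (Rle_trans _ ((x i - y i) ^ 2 + 0)); first by rewrite /Rsqr /=; lra.
by apply: Rplus_le_compat_l; apply: rsum_ge0 => j _; apply: pow2_ge_0.
Qed.

Lemma dist_le_coord x y (h : R) :
  0 <= h -> (forall i, Rabs (x i - y i) <= h) -> dist_euc x y <= INR d * h.
Proof.
move=> h0 H; case: (posnP d) => [d0|dp].
  rewrite /dist_euc big1 ?sqrt_0; first by rewrite d0 /=; lra.
  by case=> i li; exfalso; move: (li); rewrite d0.
have d1 : 1 <= INR d by rewrite -INR_1; apply: le_INR; apply/leP.
have dh : 0 <= INR d * h by nra.
rewrite -(sqrt_Rsqr (INR d * h)) //; apply: sqrt_le_1_alt.
apply: (@Rle_trans _ (\rsum_(i < d) (h ^ 2))).
  apply: rsum_le => i _; rewrite -Rsqr_pow2 -Rsqr_pow2.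
  by apply: Rsqr_le_abs_1; rewrite (Rabs_pos_eq h).
rewrite rsum_const -[size _]/(size (index_enum 'I_d)).
rewrite [size _](_ : _ = d) /Rsqr; last first.
  by rewrite -[index_enum _]enumT -cardT card_ord.
have : 0 <= h * h by nra.
by rewrite /=; nra.
Qed.

Lemma point_ext x y : (forall e, 0 < e -> dist_euc x y < e) -> x = y.
Proof.
move=> H; apply: FunctionalExtensionality.functional_extensionality => i.
case: (Req_dec (x i) (y i)) => // ne.
have p : 0 < Rabs (x i - y i) by apply: Rabs_pos_lt; lra.
by have := H _ p; have := coord_le_dist x y i; lra.
Qed.

Lemma diam_le U (h : R) :
  (forall x y, U x -> U y -> dist_euc x y <= h) -> Rbar_le (diam U) h.
Proof.
move=> H; apply: (proj2 (Lub_Rbar_correct _)).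
by move=> r [x [y [Ux [Uy ->]]]]; apply: H.
Qed.

Lemma dist_le_diam U x y : U x -> U y -> Rbar_le (dist_euc x y) (diam U).
Proof.
move=> Ux Uy; apply: (proj1 (Lub_Rbar_correct _)).
by exists x, y.
Qed.

Lemma diam_pow_ge0 (s : R) U : 0 <= diam_pow s U.
Proof.
unfold diam_pow; case: (diam U) => [r||]; try lra.
case: (Rlt_dec 0 r) => ? /=; first by apply: Rlt_le; apply: exp_pos.
by case: (Req_EM_T s 0) => ? /=; lra.
Qed.

Lemma diam_pow_empty (s : R) U : (forall x, ~ U x) -> diam_pow s U = 0.
Proof.
move=> U0; unfold diam_pow.
have : Rbar_le (diam U) m_infty.
  by apply: (proj2 (Lub_Rbar_correct _)) => r [x [y [/U0]]].
by case: (diam U).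
Qed.

Lemma diam_pow_le (s h : R) U :
  0 < s -> 0 < h -> (forall x y, U x -> U y -> dist_euc x y <= h) ->
  diam_pow s U <= Rpower h s.
Proof.
move=> s0 h0 H; have p : 0 < Rpower h s by apply: exp_pos.
have dh := diam_le H; unfold diam_pow.
case: (diam U) dh => [r||] //= rh; try lra.
case: (Rlt_dec 0 r) => rp; first by apply: Rle_Rpower_l; lra.
by case: (Req_EM_T s 0) => ? /=; lra.
Qed.

Lemma hausdorff_measure_eq0 (s : R) (A : point d -> Prop) :
  (forall eps eta, 0 < eps -> 0 < eta -> exists U : nat -> point d -> Prop,
     is_cover eps A U /\
     exists t, t <= eta /\ is_series (fun i => diam_pow s (U i)) t) ->
  hausdorff_measure s A = Finite 0.
Proof.
move=> H; apply: Rbar_is_lub_unique.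
have pm eps : 0 < eps -> hausdorff_premeasure s eps A = Finite 0.
  move=> eps0; apply: is_glb_Rbar_unique; split.
    move=> t [U [_ st]] /=.
    have := series_ge_partial 0 (fun i => diam_pow_ge0 s (U i)) st.
    by rewrite big_ord0.
  move=> [l||] lb //=; last first.
    have [U [cU [t [_ st]]]] := H eps 1 eps0 Rlt_0_1.
    exact: (lb t (ex_intro _ U (conj cU st))).
  apply: Rnot_lt_le => l0.
  have [U [cU [t [tl st]]]] := H eps (l / 2) eps0 ltac:(lra).
  have /= := lb t (ex_intro _ U (conj cU st)); lra.
split.
  by move=> h [eps [eps0 ->]]; rewrite pm //; apply: Rbar_le_refl.
by move=> l ub; apply: ub; exists 1; split; [lra | rewrite pm //; lra].
Qed.

Lemma hausdorff_measure_eq0_cover (s eps eta : R) (A : point d -> Prop) :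
  hausdorff_measure s A = Finite 0 -> 0 < eps -> 0 < eta ->
  exists U : nat -> point d -> Prop, is_cover eps A U /\
    exists t, t < eta /\ is_series (fun i => diam_pow s (U i)) t.
Proof.
move=> H eps0 eta0; apply: NNPP => nU.
have : Rbar_le eta (hausdorff_premeasure s eps A).
  apply: (proj2 (Glb_Rbar_correct _)) => t [U [cU st]] /=.
  by apply: Rnot_lt_le => tl; apply: nU; exists U; split=> //; exists t.
have : Rbar_le (hausdorff_premeasure s eps A) (hausdorff_measure s A).
  apply: (proj1 (proj2_sig (Rbar_ex_lub _))).
  by exists eps.
by rewrite H => h1 /Rbar_le_trans /(_ h1) /=; lra.
Qed.

End Euclidean.

(** * Cells *)

Section Cells.
Variables (d b : nat).

Definition digit : Type := {ffun 'I_d -> 'I_b.+1}.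
HB.instance Definition _ := Finite.on digit.

Implicit Types (q : seq digit) (y z : point d) (side : R).

Definition idx q (i : 'I_d) : nat :=
  foldl (fun n (x : digit) => n * b.+1 + x i)%N 0%N q.

Definition base : R := INR b.+1.

(** The cells of level [m] subdivide the cube of side [side] centred at the
    origin into [b.+1 ^ (m * d)] closed cubes. A point on a face has several
    addresses; this costs only a constant factor in the counts. *)
Definition cell (side : R) q y : Prop := forall i,
  INR (idx q i) <= (y i / side + / 2) * base ^ size q <= INR (idx q i) + 1.

Lemma base_ge1 : 1 <= base.
Proof. by rewrite /base S_INR; have := pos_INR b; lra. Qed.

Lemma base_pow_gt0 m : 0 < base ^ m.
Proof. by apply: pow_lt; have := base_ge1; lra. Qed.

Lemma idx_rcons q x i : idx (rcons q x) i = (idx q i * b.+1 + x i)%N.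
Proof. exact: foldl_rcons. Qed.

Lemma idx_inj q q' : size q = size q' -> idx q =1 idx q' -> q = q'.
Proof.
elim/last_ind: q q' => [|q x IH] q'; first by case: q'.
case/lastP: q' => [|q' x']; first by rewrite size_rcons.
rewrite !size_rcons => -[sq] E.
have E' i : idx q i = idx q' i /\ x i = x' i.
  have := E i; rewrite !idx_rcons => Ei; split.
    have := congr1 (fun n => n %/ b.+1)%N Ei.
    by rewrite /= !divnMDl // !divn_small ?ltn_ord // !addn0.
  apply: ord_inj; have := congr1 (fun n => n %% b.+1)%N Ei.
  by rewrite /= !modnMDl !modn_small ?ltn_ord.
rewrite (IH q') //; last by move=> i; case: (E' i).
by congr rcons; apply/ffunP => i; case: (E' i).
Qed.

Lemma cell_nil side y : 0 < side -> (forall i, Rabs (y i) <= side / 2) ->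
  cell side [::] y.
Proof.
move=> side0 H i; have /Rabs_le_between yi := H i.
have E : y i = (y i / side) * side by field; lra.
by rewrite /=; nra.
Qed.

Lemma cell_child side q y : cell side q y -> exists x, cell side (rcons q x) y.
Proof.
move=> cy.
have H i : exists j : 'I_b.+1,
  INR (idx q i) * base + INR j <= (y i / side + / 2) * base ^ (size q).+1
    <= INR (idx q i) * base + INR j + 1.
  have [l u] := cy i; set v := (y i / side + / 2) * base ^ (size q) in l u.
  have -> : (y i / side + / 2) * base ^ (size q).+1 = v * base.
    by rewrite /v /=; lra.
  set n := INR (idx q i) in l u *.
  have b1 := base_ge1.
  (* The last of the [b.+1] subintervals whose left end is at most [v]. *)
  pose left_of j := (j < b.+1)%N && holds (n * base + INR j <= v * base).
  have ex0 : exists j, left_of j.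
    by exists 0%N; apply/andP; split=> //; apply/holdsP => /=; nra.
  have ub j : left_of j -> (j <= b)%N by case/andP.
  case: (ex_maxnP ex0 ub) => j /andP[jb /holdsP jl] jmax.
  exists (Ordinal jb); split=> //=.
  apply: Rnot_lt_le => lt.
  have jmaxS : (j.+1 < b.+1)%N -> False.
    move=> jb1; have := jmax j.+1; rewrite ltnn /left_of jb1.
    case: holdsP => [_ /(_ isT)|[]] //.
    by rewrite S_INR; lra.
  have E : j = b by apply/eqP; rewrite eqn_leq -ltnS jb leqNgt; apply/negP.
  by move: lt; rewrite E; move: u b1; rewrite /base S_INR; nra.
exists [ffun i => odflt ord0 [pick j : 'I_b.+1 | holds
  (INR (idx q i) * base + INR j <= (y i / side + / 2) * base ^ (size q).+1
     <= INR (idx q i) * base + INR j + 1)]] => i.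
rewrite size_rcons idx_rcons INR_addn INR_muln -/base ffunE.
case: pickP => [j /holdsP //|/=].
by have [j hj] := H i; move/(_ j)/holdsP.
Qed.

Lemma cell_dist side q y z : 0 < side -> cell side q y -> cell side q z ->
  dist_euc y z <= INR d * (side / base ^ size q).
Proof.
move=> side0 cy cz.
have bp := base_pow_gt0 (size q).
apply: dist_le_coord; first by apply: Rlt_le; apply: Rdiv_lt_0_compat.
move=> i; have := cy i; have := cz i.
set p := base ^ _ in bp *.
have -> : y i - z i
    = ((y i / side + / 2) * p - (z i / side + / 2) * p) * (side / p).
  by field; lra.
move=> h1 h2; rewrite Rabs_mult (Rabs_pos_eq (side / p)); last first.
  by apply: Rlt_le; apply: Rdiv_lt_0_compat.
rewrite -[X in _ <= X]Rmult_1_l; apply: Rmult_le_compat_r.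
  by apply: Rlt_le; apply: Rdiv_lt_0_compat.
by apply/Rabs_le_between; lra.
Qed.

Lemma cell_near side q q' m y z i : 0 < side -> size q = m -> size q' = m ->
  cell side q y -> cell side q' z -> dist_euc y z <= side / base ^ m ->
  (idx q i <= idx q' i + 2)%N.
Proof.
move=> side0 sq sq' cy cz dyz.
have bp := base_pow_gt0 m.
have /Rabs_le_between yz := Rle_trans _ _ _ (coord_le_dist y z i) dyz.
have := cy i; have := cz i; rewrite sq sq'; set p := base ^ _ in bp yz *.
have E : (y i / side + / 2) * p
    = (z i / side + / 2) * p + (y i - z i) * (p / side).
  by field; lra.
have h : (y i - z i) * (p / side) <= 1.
  have -> : 1 = (side / p) * (p / side) by field; lra.
  apply: Rmult_le_compat_r; last by lra.
  by apply: Rlt_le; apply: Rdiv_lt_0_compat.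
move=> h1 h2; apply/leP; apply: INR_le; rewrite INR_addn /=; lra.
Qed.

(** In each direction the indices of two such cells differ by at most [2], so
    relative to one of them each of the [d] indices takes [5] values. *)
Lemma card_cells_meeting side (U : point d -> Prop) m (r : seq (seq digit)) :
  0 < side -> (forall y z, U y -> U z -> dist_euc y z <= side / base ^ m) ->
  uniq r ->
  (forall q, q \in r -> size q = m /\ exists y, U y /\ cell side q y) ->
  (size r <= 5 ^ d)%N.
Proof.
move=> side0 HU ur Hr; case: r ur Hr => [//|q0 r].
move: (q0 :: r) (mem_head q0 r) => {}r q0r ur Hr.
have [s0 [y0 [Uy0 cy0]]] := Hr _ q0r.
have near q i : q \in r ->
    (idx q i <= idx q0 i + 2)%N /\ (idx q0 i <= idx q i + 2)%N.
  move=> /Hr [sq [y [Uy cy]]]; split.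
    exact: (cell_near i side0 sq s0 cy cy0 (HU _ _ Uy Uy0)).
  exact: (cell_near i side0 s0 sq cy0 cy (HU _ _ Uy0 Uy)).
pose F q : {ffun 'I_d -> 'I_5} := [ffun i => inord (idx q i + 2 - idx q0 i)].
have Finj : {in r &, injective F}.
  move=> q q' qr q'r E; apply: idx_inj.
    by case: (Hr _ qr) (Hr _ q'r) => [-> _] [-> _].
  move=> i; have := congr1 (fun f : {ffun 'I_d -> 'I_5} => val (f i)) E.
  have [h1 h2] := near q i qr; have [h3 h4] := near q' i q'r.
  rewrite /= !ffunE !inordK; move: h1 h2 h3 h4;
    move: (idx q i) (idx q' i) (idx q0 i) => u v w;
    rewrite -?(rwP leP) -!plusE -?minusE; lia.
have := uniq_leq_size (s1 := map F r) (s2 := enum {ffun 'I_d -> 'I_5}).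
rewrite map_inj_in_uniq // ur size_map -cardE card_ffun !card_ord.
by apply=> // f _; rewrite mem_enum.
Qed.

End Cells.
(** * A large tree of cells contains a compact set of large dimension *)

Lemma pow_unbounded (x y : R) : 1 < x -> exists m, y < x ^ m.
Proof.
move=> x1; have [|N HN] := Pow_x_infinity x _ (y + 1).
  by rewrite Rabs_pos_eq; lra.
exists N; have := HN N (le_n N); rewrite Rabs_pos_eq; first lra.
by apply: pow_le; lra.
Qed.

Lemma Rpower_pow_comm (x s : R) n : 0 < x -> Rpower (x ^ n) s = Rpower x s ^ n.
Proof.
move=> x0; rewrite -Rpower_pow // -Rpower_pow; last exact: exp_pos.
by rewrite !Rpower_mult Rmult_comm.
Qed.

Lemma Rpower_div_pow (r x s : R) n : 0 < r -> 0 < x ->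
  Rpower (r / x ^ n) s * Rpower x s ^ n = Rpower r s.
Proof.
move=> r0 x0; have xn := pow_lt x n x0.
rewrite -Rpower_pow_comm // Rpower_mult_distr //; last exact: Rdiv_lt_0_compat.
by congr Rpower; field; lra.
Qed.

Lemma last_true (P : nat -> Prop) n : P 0%N -> ~ P n ->
  exists m, P m /\ ~ P m.+1.
Proof.
move=> P0; elim: n => [//|n IH] nP.
by case: (classic (P n)) => [|/IH //]; exists n.
Qed.

Lemma rsum_if_le (T : eqType) (r : seq T) (P : pred T) (w : T -> R) (h n : R) :
  0 <= h -> (forall x, x \in r -> w x <= h) ->
  INR (size (filter P r)) <= n ->
  \rsum_(x <- r) ((if P x then 1 else 0) * w x) <= n * h.
Proof.
move=> h0 wh sn.
apply: (@Rle_trans _ (\rsum_(x <- filter P r) h)); last first.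
  by rewrite rsum_const; apply: Rmult_le_compat_r.
rewrite big_filter [X in _ <= X]big_mkcond.
rewrite big_seq [X in _ <= X]big_seq; apply: rsum_le => x xr.
by have := wh x xr; case: ifP => _; lra.
Qed.

Section LargeTree.
Variables (d b : nat) (side c delta : R) (A : point d -> Prop).
Variable S : seq (digit d b) -> {set digit d b}.
Notation digit := (digit d b).
Notation base := (base b).
Hypotheses (b1 : 1 < base) (side0 : 0 < side) (c0 : 0 < c).
Hypothesis S_large : forall q,
  c * Rpower base delta ^ size q <= nodeprod (fun q _ => INR #|S q|) q.
Hypothesis S_points : forall a, legal_branch S a ->
  exists y, A y /\ forall m, cell side (mkseq a m) y.

Let K (y : point d) : Prop :=
  exists a, legal_branch S a /\ forall m, cell side (mkseq a m) y.

Lemma exists_small_cell (k r : R) : 0 < r ->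
  exists m, k * (side / base ^ m) < r.
Proof.
move=> r0; have [m hm] := pow_unbounded (k * side / r) b1.
exists m; have bm : 0 < base ^ m by apply: pow_lt; lra.
have rb : 0 < r / base ^ m by apply: Rdiv_lt_0_compat.
have := Rmult_lt_compat_r _ _ _ rb hm.
rewrite (_ : _ / r * _ = k * (side / base ^ m)); last by field; lra.
by rewrite (_ : base ^ m * _ = r) //; field; lra.
Qed.

Lemma branch_point_unique (a : nat -> digit) y z :
  (forall m, cell side (mkseq a m) y) ->
  (forall m, cell side (mkseq a m) z) -> y = z.
Proof.
move=> cy cz; apply: point_ext => e /(exists_small_cell (INR d)) [m hm].
by have := cell_dist side0 (cy m) (cz m); rewrite size_mkseq; lra.
Qed.

Lemma points_of_branches_subset : subset K A.
Proof.
move=> y [a [la cy]]; have [z [Az cz]] := S_points la.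
by rewrite (branch_point_unique cy cz).
Qed.

(** The bars are the nodes whose cell lies in a member of the open cover. *)
Lemma points_of_branches_compact : compact_set K.
Proof.
move=> C Copen Ccov.
pose bar (q : seq digit) := exists U, C U /\ forall y, cell side q y -> U y.
have [a la|M HM] := @fan _ S bar.
  have [y [_ cy]] := S_points la.
  have [|U [CU Uy]] := Ccov y; first by exists a.
  have [r [r0 rU]] := Copen U CU y Uy.
  have [m hm] := exists_small_cell (INR d) r0.
  exists m, U; split=> // z cz; apply: rU.
  by have := cell_dist side0 (cy m) cz; rewrite size_mkseq; lra.
have [l [lC Hl]] : exists l : list (point d -> Prop),
    (forall U, List.In U l -> C U) /\
    forall q, q \in level digit M -> legal S q ->
    exists U m, List.In U l /\ (m <= M)%N /\
      forall y, cell side (take m q) y -> U y.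
  have : forall q, q \in level digit M -> size q = M.
    by move=> q; rewrite mem_level => /eqP.
  elim: (level digit M) => [|q r IH] Hr; first by exists [::].
  have [q' q'r|l [lC Hl]] := IH; first by apply: Hr; rewrite inE q'r orbT.
  case: (classic (legal S q)) => [lq|nlq]; last first.
    exists l; split=> // q'; rewrite inE => /orP[/eqP ->|] //; exact: Hl.
  have [m mM [U [CU hU]]] := HM q lq (Hr q (mem_head _ _)).
  exists (U :: l); split=> [V [<-|/lC]//|q'].
  rewrite inE => /orP[/eqP -> _|q'r lq'].
    by exists U, m; split; [left|].
  by have [V [n [Vl h]]] := Hl _ q'r lq'; exists V, n; split; [right|].
exists l; split=> // y [a [la cy]].
have [||U [m [Ul [mM HU]]]] := Hl (mkseq a M).
- by rewrite mem_level size_mkseq.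
- exact: legal_mkseq.
by exists U; split=> //; apply: HU; rewrite take_mkseq.
Qed.

Let child_mass q (x : digit) : R := if x \in S q then / INR #|S q| else 0.

Lemma S_card_gt0 q : 0 < INR #|S q|.
Proof.
case: (posnP #|S q|) => [E|/ltP/lt_INR //].
have h := S_large (rcons q [ffun=> ord0]).
rewrite nodeprod_rcons E INR_0 Rmult_0_r in h; case: (Rle_not_lt _ _ h).
by apply: Rmult_lt_0_compat => //; apply: pow_lt; apply: exp_pos.
Qed.

Lemma child_mass_ge0 q x : 0 <= child_mass q x.
Proof.
rewrite /child_mass; case: ifP => _; last lra.
by apply: Rlt_le; apply: Rinv_0_lt_compat; apply: S_card_gt0.
Qed.

Lemma child_mass_sum q : \big[Rplus/0]_x child_mass q x = 1.
Proof.
rewrite -big_mkcond -big_enum rsum_const -cardE.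
by apply: Rinv_r; apply: Rgt_not_eq; apply: S_card_gt0.
Qed.

Lemma mass_legal q : nodeprod child_mass q <> 0 -> legal S q.
Proof.
elim/last_ind: q => [|q x IH]; first by move=> _ [].
rewrite nodeprod_rcons /child_mass; case: ifP => [xq H|_]; last lra.
by apply: legal_rcons => //; apply: IH => E; rewrite E in H; lra.
Qed.

(** On legal nodes this is the hypothesis on the product of the sizes, and other
    nodes have no mass. *)
Lemma mass_le q : nodeprod child_mass q <= / (c * Rpower base delta ^ size q).
Proof.
have cb : 0 < c * Rpower base delta ^ size q.
  by apply: Rmult_lt_0_compat => //; apply: pow_lt; apply: exp_pos.
have p0 := nodeprod_ge0 q child_mass_ge0.
have : nodeprod child_mass q * nodeprod (fun q _ => INR #|S q|) q <= 1.
  elim/last_ind: {cb p0} q => [|q x IH]; first by rewrite /=; lra.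
  rewrite !nodeprod_rcons.
  have h : child_mass q x * INR #|S q| <= 1.
    have S0 := S_card_gt0 q; rewrite /child_mass; case: ifP => _; last lra.
    by rewrite Rinv_l; lra.
  have h0 : 0 <= child_mass q x * INR #|S q|.
    by apply: Rmult_le_pos (child_mass_ge0 _ _) _; have := S_card_gt0 q; lra.
  have n0 : 0 <= nodeprod child_mass q * nodeprod (fun q _ => INR #|S q|) q.
    apply: Rmult_le_pos; apply: nodeprod_ge0; first exact: child_mass_ge0.
    by move=> q' _; have := S_card_gt0 q'; lra.
  by nra.
have := S_large q => h1 h2.
apply: (Rmult_le_reg_r (c * Rpower base delta ^ size q)) => //.
by rewrite Rinv_l; [nra | lra].
Qed.

Lemma mass_total m : \rsum_(q <- level digit m) nodeprod child_mass q = 1.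
Proof.
have := rsum_level_marginal (fun _ => 1) 0 m child_mass_sum.
by rewrite add0n big_seq1 /= Rmult_1_l => <-; apply: eq_bigr => q _; lra.
Qed.

(** The mass distribution principle at a single scale: boundedly many cells of
    level [m] meet a set of their size, and each has little mass. *)
Lemma mass_meeting_le (U : point d -> Prop) m (P : pred (seq digit)) :
  (forall y z, U y -> U z -> dist_euc y z <= side / base ^ m) ->
  (forall q, P q -> exists y, U y /\ cell side q y) ->
  \rsum_(q <- level digit m) ((if P q then 1 else 0) * nodeprod child_mass q)
  <= INR (5 ^ d) * / (c * Rpower base delta ^ m).
Proof.
move=> Um PU; apply: rsum_if_le.
- apply: Rlt_le; apply: Rinv_0_lt_compat.
  by apply: Rmult_lt_0_compat => //; apply: pow_lt; apply: exp_pos.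
- by move=> q; rewrite mem_level => /eqP <-; apply: mass_le.
apply: le_INR; apply/leP; apply: (card_cells_meeting side0 Um).
  by apply: filter_uniq; apply: uniq_level.
by move=> q; rewrite mem_filter mem_level => /andP[/PU ? /eqP].
Qed.

(** For a set of positive diameter the level is the one whose cells have about
    that diameter; a set with at most one point is charged an arbitrarily small
    amount by cells deep enough. *)
Lemma exists_scale (s e : R) (U : point d -> Prop) :
  0 <= s < delta -> 0 < e -> Rbar_le (diam U) side ->
  exists m, (forall y z, U y -> U z -> dist_euc y z <= side / base ^ m) /\
    INR (5 ^ d) * / (c * Rpower base delta ^ m)
    <= INR (5 ^ d) / c * (Rpower base s / Rpower side s) * diam_pow s U + e.
Proof.
move=> [s0 sd] e0 dU.
set g := Rpower base s; set B := Rpower base delta.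
have N0 : 0 < INR (5 ^ d) / c.
  apply: Rdiv_lt_0_compat => //.
  by apply: lt_0_INR; apply/ltP; rewrite expn_gt0.
have g1 : 1 <= g.
  by rewrite -(Rpower_O base); [apply: Rle_Rpower; lra | lra].
have gB : g < B by apply: Rpower_lt.
have Rs : 0 < Rpower side s by apply: exp_pos.
have bp m : 0 < base ^ m by apply: pow_lt; lra.
have Bp m : 0 < B ^ m by apply: pow_lt; lra.
have gp m : 0 < g ^ m by apply: pow_lt; lra.
have E m : INR (5 ^ d) * / (c * B ^ m) = INR (5 ^ d) / c * / B ^ m.
  by field; have := Bp m; lra.
have C0 : 0 <= INR (5 ^ d) / c * (g / Rpower side s) * diam_pow s U.
  apply: Rmult_le_pos (diam_pow_ge0 _ _).
  by apply: Rmult_le_pos; [lra | apply: Rlt_le; apply: Rdiv_lt_0_compat; lra].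
case: (classic (exists r, diam U = Finite r /\ 0 < r)) => [[r [rU r0]]|nr].
  have [n hn] := exists_small_cell 1 r0.
  have [||m [rm rm1]] := @last_true (fun m => r <= side / base ^ m) n.
  - by move: dU; rewrite rU /=; lra.
  - by lra.
  exists m; split.
    by move=> y z Uy Uz; have := dist_le_diam Uy Uz; rewrite rU /=; lra.
  have h1 : Rpower side s <= diam_pow s U * g ^ m.+1.
    rewrite -(Rpower_div_pow s m.+1 side0 (_ : 0 < base)); last lra.
    apply: Rmult_le_compat_r; first exact: Rlt_le (gp _).
    rewrite /diam_pow rU; case: Rlt_dec => //= _.
    apply: Rle_Rpower_l => //; split.
      exact: (Rdiv_lt_0_compat _ _ side0 (bp m.+1)).
    exact: Rlt_le (Rnot_le_lt _ _ rm1).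
  have h2 : / B ^ m <= / g ^ m.
    by apply: Rinv_le_contravar => //; apply: pow_incr; lra.
  have h3 : / g ^ m <= g / Rpower side s * diam_pow s U.
    apply: (Rmult_le_reg_r (g ^ m * Rpower side s)).
      exact: Rmult_lt_0_compat.
    rewrite (_ : / g ^ m * _ = Rpower side s); last by field; have := gp m; lra.
    rewrite (_ : g / Rpower side s * _ * _ = diam_pow s U * g ^ m.+1) //.
    by rewrite /=; field; lra.
  rewrite E Rmult_assoc.
  have := Rmult_le_compat_l _ _ _ (Rlt_le _ _ N0) (Rle_trans _ _ _ h2 h3).
  by lra.
have [m hm] := @pow_unbounded B (INR (5 ^ d) / c / e) ltac:(lra).
exists m; split.
  move=> y z Uy Uz; apply: (@Rle_trans _ 0); last first.
    by apply: Rlt_le; apply: Rdiv_lt_0_compat.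
  have := dist_le_diam Uy Uz; case: (diam U) dU nr => [r||] //= _ nr yr.
  by apply: Rnot_lt_le => y0; apply: nr; exists r; split=> //; lra.
apply: (@Rle_trans _ e); last lra.
rewrite E; apply: (Rmult_le_reg_r (B ^ m / e)).
  exact: Rdiv_lt_0_compat.
have Bm := Bp m.
rewrite (_ : _ * / B ^ m * _ = INR (5 ^ d) / c / e); last by field; lra.
by rewrite (_ : e * _ = B ^ m); [lra | field; lra].
Qed.

(** A cover of small cost, discretized at the scale of each of its members, would
    bar all the branches; by the fan theorem finitely many members would already
    do so, and the cells meeting them would carry the total mass [1]. *)
Lemma le_HD_points_of_branches : Rbar_le (Finite delta) (HD K).
Proof.
apply: (proj2 (Glb_Rbar_correct _)) => s [s0 Hs] /=.
apply: Rnot_lt_le => sd.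
set Cst := INR (5 ^ d) / c * (Rpower base s / Rpower side s).
have Cst0 : 0 < Cst.
  apply: Rmult_lt_0_compat; apply: Rdiv_lt_0_compat => //; try exact: exp_pos.
  by apply: lt_0_INR; apply/ltP; rewrite expn_gt0.
have eta0 : 0 < / (4 * Cst) by apply: Rinv_0_lt_compat; lra.
have [U [[Ud Ucov] [t [tl st]]]] := hausdorff_measure_eq0_cover Hs side0 eta0.
have [i|f Hf] := @nat_choice (fun i m =>
    (forall y z, U i y -> U i z -> dist_euc y z <= side / base ^ m) /\
    INR (5 ^ d) * / (c * Rpower base delta ^ m)
      <= Cst * diam_pow s (U i) + (/ 2) ^ i.+2).
  by apply: exists_scale => //; apply: pow_lt; lra.
pose meets i (q : seq digit) := exists y, U i y /\ cell side q y.
have [a la|M HM] := @fan _ S (fun q => exists i, size q = f i /\ meets i q).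
  have [y [_ cy]] := S_points la.
  have [|i Uy] := Ucov y; first by exists a.
  by exists (f i), i; rewrite size_mkseq; split=> //; exists y.
have [||I HI] := @uniform_bound _ (level digit M) (fun q I => legal S q ->
    exists2 i, (i < I)%N & (f i <= M)%N /\ meets i (take (f i) q)).
- move=> q m n H mn /H [i im h]; exists i => //; exact: leq_trans mn.
- move=> q; rewrite mem_level => /eqP sq.
  case: (classic (legal S q)) => [lq|]; last by exists 0%N.
  have [m mM [i [si mi]]] := HM q lq sq.
  rewrite size_takel ?sq // in si.
  by exists i.+1 => _; exists i => //; rewrite -si.
pose P i q := holds (meets i q).
have PP i q : P i q -> meets i q by move/holdsP.
pose F i q :=
  (if (f i <= M)%N && P i (take (f i) q) then 1 else 0) * nodeprod child_mass q.
have F0 i q : 0 <= F i q.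
  have n0 := nodeprod_ge0 q child_mass_ge0; rewrite /F; case: ifP => _; lra.
have h1 : 1 <= \rsum_(q <- level digit M) \rsum_(i < I) F i q.
  rewrite -(mass_total M) big_seq [X in _ <= X]big_seq.
  apply: rsum_le => q qM.
  case: (Req_dec (nodeprod child_mass q) 0) => [->|/mass_legal lq].
    by apply: rsum_ge0.
  have [i iI [fiM mi]] := HI q qM lq.
  rewrite (bigD1 (Ordinal iI)) //.
  apply: (@Rle_trans _ (F i q + 0)); last first.
    by apply: Rplus_le_compat_l; apply: rsum_ge0.
  by rewrite /F fiM /P /=; case: holdsP => [?|[]] //=; lra.
have h2 i : \rsum_(q <- level digit M) F i q
    <= Cst * diam_pow s (U i) + / 4 * (/ 2) ^ i.
  have [Ui Ei] := Hf i.
  rewrite /F; case: (leqP (f i) M) => fiM; last first.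
    rewrite big1; last by move=> q _ /=; lra.
    have := diam_pow_ge0 s (U i); have : 0 < (/ 2) ^ i by apply: pow_lt; lra.
    by nra.
  rewrite -(subnKC fiM).
  rewrite (rsum_level_marginal (fun q => if P i q then 1 else 0)); last first.
    exact: child_mass_sum.
  apply: Rle_trans (mass_meeting_le Ui (PP i)) _.
  by move: Ei => /=; lra.
have h3 : \rsum_(i < I) (Cst * diam_pow s (U i) + / 4 * (/ 2) ^ i) <= 3 / 4.
  rewrite big_split -!big_distrr.
  have := series_ge_partial I (fun i => diam_pow_ge0 s (U i)) st.
  have := @rsum_geom_le (/ 2) I ltac:(lra).
  have -> : 3 / 4 = Cst * (/ (4 * Cst)) + / 4 * 2 by field; lra.
  move=> g1 g2; apply: Rplus_le_compat.
    apply: (Rmult_le_compat_l Cst); first lra.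
    exact: Rle_trans g2 (Rlt_le _ _ tl).
  by apply: (Rmult_le_compat_l (/ 4)) g1; lra.
rewrite exchange_big in h1.
have h4 := Rle_trans _ _ _ h1 (rsum_le (fun (i : 'I_I) _ => h2 i)).
by have := Rle_trans _ _ _ h4 h3; lra.
Qed.

Lemma compact_of_tree :
  exists K, subset K A /\ compact_set K /\ Rbar_le (Finite delta) (HD K).
Proof.
exists K; split; first exact: points_of_branches_subset.
by split; [exact: points_of_branches_compact | exact: le_HD_points_of_branches].
Qed.

End LargeTree.
(** * Covers by rejected cells *)

Lemma rsum_oapp (I T : Type) (r : seq I) (f : I -> option T) (G : T -> R) :
  \rsum_(i <- r) oapp G 0 (f i) = \rsum_(x <- pmap f r) G x.
Proof.
elim: r => [|i r IH]; first by rewrite !big_nil.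
rewrite big_cons /= IH; case: (f i) => [x|] /=; first by rewrite big_cons.
exact: Rplus_0_l.
Qed.

Lemma series_countable (T : countType) (u : nat -> R) (G : T -> R) (B : R) :
  (forall i, 0 <= u i) -> (forall i, u i <= oapp G 0 (pickle_inv i)) ->
  (forall r : seq T, uniq r -> \rsum_(x <- r) G x <= B) ->
  exists t, t <= B /\ is_series u t.
Proof.
move=> u0 uG HB; apply: series_le_bound => // n.
apply: (@Rle_trans _ (\rsum_(i < n) oapp G 0 (@pickle_inv T i))).
  by apply: rsum_le.
rewrite -(big_mkord xpredT (fun i => oapp G 0 (@pickle_inv T i))) rsum_oapp.
by apply: HB; apply: pmap_uniq (iota_uniq _ _); apply: pickle_invK.
Qed.

Lemma pow_half_small (x : R) : 0 < x -> exists n, (/ 2) ^ n < x.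
Proof.
move=> x0; have [n hn] := @pow_unbounded 2 (/ x) ltac:(lra).
exists n; rewrite pow_inv; apply: (Rmult_lt_reg_r (2 ^ n / x)).
  by apply: Rdiv_lt_0_compat => //; apply: pow_lt; lra.
have p : 0 < 2 ^ n by apply: pow_lt; lra.
rewrite (_ : / 2 ^ n * _ = / x); last by field; lra.
by rewrite (_ : x * _ = 2 ^ n) //; field; lra.
Qed.

Section Covers.
Variables (d b : nat) (delta s : R) (A : point d -> Prop).
Notation digit := (digit d b).
Notation base := (base b).
Notation beta := (Rpower base delta).
Notation gamma := (Rpower base s).

Definition side (k : nat) : R := INR k.+1.

(** The denominator cancels the size of the initial cube, so that the rejected
    cells inside it cost at most a multiple of [2 ^ - k] whatever their level:
    see [rejected_diam]. *)
Definition threshold (k : nat) : R := (/ 2) ^ k / Rpower (INR d * side k) s.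

Variables (e : nat -> seq digit -> digit -> {set digit}) (L : R).
Hypotheses (d_gt0 : (0 < d)%N) (s_gt0 : 0 < s) (delta_s : delta <= s).
Hypothesis e_gt0 : forall k q x, (0 < #|e k q x|)%N.
Hypothesis e_sum : forall k q,
  \big[Rplus/0]_(x : digit) / INR #|e k q x| <= L.
Hypothesis L_small : 2 * L * beta <= gamma.
Hypothesis A_rejected : forall k y, A y -> cell (side k) ([::] : seq digit) y ->
  exists q : seq digit, cell (side k) q y /\
    nodeprod (fun q x => INR #|e k q x|) q < threshold k * beta ^ size q.

Let weight k q := nodeprod (fun q x => / INR #|e k q x|) q.
Let rejected k q :=
  nodeprod (fun q x => INR #|e k q x|) q < threshold k * beta ^ size q.

Lemma side_gt0 k : 0 < side k.
Proof. by apply: lt_0_INR; apply/ltP. Qed.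

Lemma e_ge1 k q x : 1 <= INR #|e k q x|.
Proof. by rewrite -INR_1; apply: le_INR; apply/leP. Qed.

Lemma nodeprod_ge1 k q : 1 <= nodeprod (fun q x => INR #|e k q x|) q.
Proof.
elim/last_ind: q => [|q x IH]; first by rewrite /=; lra.
rewrite nodeprod_rcons -[1]Rmult_1_r.
by apply: Rmult_le_compat IH (e_ge1 k q x); lra.
Qed.

Lemma weight_mul k q : weight k q * nodeprod (fun q x => INR #|e k q x|) q = 1.
Proof.
elim/last_ind: q => [|q x IH]; first by rewrite /weight /=; lra.
rewrite /weight !nodeprod_rcons -/(weight k q).
set P := nodeprod _ q in IH *; set n := INR _.
have n1 : 1 <= n := e_ge1 k q x.
by rewrite -[RHS]IH; field; lra.
Qed.

Lemma weight_ge0 k q : 0 <= weight k q.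
Proof.
apply: nodeprod_ge0 => q' x; apply: Rlt_le; apply: Rinv_0_lt_compat.
by have := e_ge1 k q' x; lra.
Qed.

Lemma ratio_bounds : 0 < beta / gamma <= 1.
Proof.
have b1 := base_ge1 b.
have g0 : 0 < gamma by apply: exp_pos.
have h : beta <= gamma.
  by case: (Req_dec base 1) => [->|n1]; [rewrite /Rpower ln_1 !Rmult_0_r; lra
    | apply: Rle_Rpower; lra].
split; first by apply: Rdiv_lt_0_compat => //; apply: exp_pos.
apply: (Rmult_le_reg_r gamma) => //.
by rewrite (_ : beta / gamma * gamma = beta); [lra | field; lra].
Qed.

(** A rejected cell has weight greater than [/ (threshold k * beta ^ m)], so its
    cost can be charged to its weight. The second bound is what makes the cells
    uniformly small when [k] is large. *)
Lemma rejected_diam k q : rejected k q ->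
  Rpower (INR d * (side k / base ^ size q)) s
    <= (/ 2) ^ k * (weight k q * (beta / gamma) ^ size q) /\
  Rpower (INR d * (side k / base ^ size q)) s <= (/ 2) ^ k.
Proof.
rewrite /rejected /threshold => rq; set m := size q in rq *.
have b0 : 0 < base by have := base_ge1 b; lra.
have ds : 0 < INR d * side k.
  apply: Rmult_lt_0_compat (side_gt0 k); apply: lt_0_INR; exact/ltP.
set D := Rpower (INR d * side k) s in rq *.
have D0 : 0 < D by apply: exp_pos.
have b1 : 0 < beta ^ m by apply: pow_lt; apply: exp_pos.
have g1 : 0 < gamma ^ m by apply: pow_lt; apply: exp_pos.
have h0 : 0 < (/ 2) ^ k by apply: pow_lt; lra.
have E : Rpower (INR d * (side k / base ^ m)) s = D / gamma ^ m.
  have := Rpower_div_pow s m ds b0; rewrite -/D => <-.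
  rewrite (_ : INR d * (side k / base ^ m) = INR d * side k / base ^ m).
    by field; lra.
  by rewrite /Rdiv; lra.
have E2 : (/ 2) ^ k * (beta / gamma) ^ m
    = (D / gamma ^ m) * ((/ 2) ^ k / D * beta ^ m).
  by rewrite Rpow_mult_distr (pow_inv gamma m); field; lra.
have [r0 r1] := ratio_bounds.
have rm : (beta / gamma) ^ m <= 1.
  by rewrite -(pow1 m); apply: pow_incr; lra.
have Dg : 0 < D / gamma ^ m by apply: Rdiv_lt_0_compat.
have X1 := nodeprod_ge1 k q.
have wX := weight_mul k q; have w0 := weight_ge0 k q.
rewrite E; set X := nodeprod _ q in rq X1 wX; set w := weight k q in wX w0 *.
have hh : D / gamma ^ m <= (/ 2) ^ k * (beta / gamma) ^ m.
  by rewrite E2 -[X in X <= _]Rmult_1_r; apply: Rmult_le_compat_l; lra.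
split; last by nra.
rewrite (_ : (/ 2) ^ k * _
  = w * ((D / gamma ^ m) * ((/ 2) ^ k / D * beta ^ m))).
  rewrite -[X in X <= _]Rmult_1_r -{1}wX -/w.
  rewrite (_ : D / gamma ^ m * (w * X) = w * (D / gamma ^ m * X)); last by lra.
  by apply: Rmult_le_compat_l => //; apply: Rmult_le_compat_l; lra.
by rewrite -E2; lra.
Qed.

Let charge k0 (x : nat * seq digit) : R :=
  if (k0 <= x.1)%N
  then (/ 2) ^ x.1 * (weight x.1 x.2 * (beta / gamma) ^ size x.2) else 0.

Lemma charge_ge0 k0 x : 0 <= charge k0 x.
Proof.
rewrite /charge; case: ifP => _; last lra.
apply: Rmult_le_pos; first by apply: pow_le; lra.
apply: Rmult_le_pos; first exact: weight_ge0.
by apply: pow_le; have := ratio_bounds; lra.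
Qed.

Lemma sum_weight_le k M :
  \rsum_(m <- index_iota 0 M) \rsum_(q <- level digit m)
     (weight k q * (beta / gamma) ^ size q) <= 2.
Proof.
have L0 : 0 <= L.
  apply: Rle_trans (e_sum 0 [::]); apply: rsum_ge0 => x _; apply: Rlt_le.
  by apply: Rinv_0_lt_compat; have := e_ge1 0 [::] x; lra.
have g0 : 0 < gamma by apply: exp_pos.
have [r0 r1] := ratio_bounds.
rewrite big_mkord.
apply: (@Rle_trans _ (\rsum_(m < M) (L * (beta / gamma)) ^ m)).
  apply: rsum_le => m _.
  have -> : \rsum_(q <- level digit m) (weight k q * (beta / gamma) ^ size q)
      = (\rsum_(q <- level digit m) weight k q) * (beta / gamma) ^ m.
    rewrite big_distrl; apply: eq_big_seq => q.
    by rewrite mem_level => /eqP ->.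
  rewrite Rpow_mult_distr.
  apply: Rmult_le_compat_r; first by apply: pow_le; lra.
  apply: rsum_level_nodeprod_le => [q x|q]; last exact: e_sum.
  by apply: Rlt_le; apply: Rinv_0_lt_compat; have := e_ge1 k q x; lra.
apply: rsum_geom_le; split; first by apply: Rmult_le_pos; lra.
apply: (Rmult_le_reg_r gamma) => //.
by rewrite (_ : L * _ * _ = L * beta); [lra | field; lra].
Qed.

Lemma sum_charge_le k0 (r : seq (nat * seq digit)) : uniq r ->
  \rsum_(x <- r) charge k0 x <= 4 * (/ 2) ^ k0.
Proof.
move=> ur.
have [||K HK] := @uniform_bound _ r (fun x K => (x.1 < K)%N).
- by move=> x m n /= h1 h2; apply: leq_trans h2.
- by move=> x _; exists x.1.+1.
have [||M HM] := @uniform_bound _ r (fun x M => (size x.2 < M)%N).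
- by move=> x m n /= h1 h2; apply: leq_trans h2.
- by move=> x _; exists (size x.2).+1.
pose r' := [seq (k, q) | k <- index_iota 0 K,
  q <- flatten [seq level digit m | m <- index_iota 0 M]].
apply: (@Rle_trans _ (\rsum_(x <- r') charge k0 x)).
  apply: rsum_subset => // [[k q] xr|]; last exact: charge_ge0.
  apply/allpairsP; exists (k, q); split=> //=.
    by rewrite mem_index_iota (HK _ xr).
  apply/flatten_mapP; exists (size q); last by rewrite mem_level.
  by rewrite mem_index_iota (HM _ xr).
rewrite big_allpairs_dep big_mkord.
apply: (@Rle_trans _
  (\rsum_(k < K) (2 * if (k0 <= k)%N then (/ 2) ^ k else 0))).
  apply: rsum_le => k _; rewrite big_flatten big_map /charge /=; case: ifP => _.
    rewrite Rmult_comm; under eq_bigr => m _ do rewrite -big_distrr.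
    rewrite -big_distrr; apply: (Rmult_le_compat_l ((/ 2) ^ k)).
      by apply: pow_le; lra.
    exact: sum_weight_le.
  by rewrite big1 => [|m _]; [lra | rewrite big1].
rewrite -big_distrr; have h := rsum_half_tail_le k0 K.
apply: Rle_trans (Rmult_le_compat_l 2 _ _ _ h) _; lra.
Qed.

(** The cubes of side [side k] increase with [k] to the whole space, so the
    scales [k0 <= k] alone give a cover of [A], and its cost is a tail of a
    geometric series. *)
Lemma null_of_rejected : hausdorff_measure s A = Finite 0.
Proof.
apply: hausdorff_measure_eq0 => eps eta eps0 eta0.
have p0 : 0 < Rpower eps s by apply: exp_pos.
have [k0 hk0] := @pow_half_small (Rmin (eta / 4) (Rpower eps s))
  ltac:(apply: Rmin_glb_lt; lra).
have hk1 := Rlt_le_trans _ _ _ hk0 (Rmin_l _ _).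
have hk2 := Rlt_le_trans _ _ _ hk0 (Rmin_r _ _).
pose V (x : nat * seq digit) (y : point d) : Prop :=
  (k0 <= x.1)%N /\ rejected x.1 x.2 /\ cell (side x.1) x.2 y.
pose U i y := oapp (fun x => V x y) False (pickle_inv i).
have Vd x y z : V x y -> V x z ->
    dist_euc y z <= INR d * (side x.1 / base ^ size x.2).
  by move=> [_ [_ cy]] [_ [_ cz]]; apply: cell_dist (side_gt0 _) cy cz.
have h0 k m : 0 < INR d * (side k / base ^ m).
  apply: Rmult_lt_0_compat; first by apply: lt_0_INR; apply/ltP.
  by apply: Rdiv_lt_0_compat (side_gt0 k) (base_pow_gt0 b m).
exists U; split; first split.
- move=> i; apply: diam_le => y z; rewrite /U; case: pickle_inv => // x Vy Vz.
  apply: Rle_trans (Vd x y z Vy Vz) _.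
  have [k0x [rx _]] := Vy.
  apply: Rnot_lt_le => lt; have [_ h2] := rejected_diam rx.
  have h3 := Rlt_Rpower_l _ _ _ s_gt0 (conj eps0 lt).
  have h4 : (/ 2) ^ x.1 <= (/ 2) ^ k0.
    rewrite !pow_inv; apply: Rinv_le_contravar; first by apply: pow_lt; lra.
    by apply: Rle_pow; [lra | apply/leP].
  exact: Rlt_not_le (Rlt_trans _ _ _ hk2 h3) (Rle_trans _ _ _ h2 h4).
- move=> y Ay.
  have [n hn] := INR_unbounded (2 * dist_euc y (fun _ => 0)).
  pose k := maxn k0 n.
  have [|q [cq rq]] := A_rejected (k := k) Ay.
    apply: (cell_nil _ (side_gt0 k)) => i.
    have := coord_le_dist y (fun _ => 0) i; rewrite Rminus_0_r.
    have : INR n <= side k.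
      by apply: le_INR; apply/leP; rewrite leqW // leq_maxr.
    by lra.
  exists (pickle (k, q)); rewrite /U pickleK_inv /=.
  by split=> //=; apply: leq_maxl.
have [|i|r ur|t [tB st]] :=
  @series_countable _ (fun i => diam_pow s (U i)) (charge k0) eta.
- by move=> i; apply: diam_pow_ge0.
- rewrite /U; case: pickle_inv => [x|] /=; last first.
    by rewrite diam_pow_empty; [lra | move=> y []].
  case: (classic ((k0 <= x.1)%N /\ rejected x.1 x.2)) => [[k0x rx]|nx].
    apply: (@Rle_trans _ (Rpower (INR d * (side x.1 / base ^ size x.2)) s)).
      by apply: diam_pow_le => //; apply: Vd.
    by rewrite /charge k0x; have [] := rejected_diam rx.
  rewrite diam_pow_empty; first exact: charge_ge0.
  by move=> y [h1 [h2 _]]; apply: nx.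
- by apply: Rle_trans (sum_charge_le k0 ur) _; lra.
by exists t.
Qed.

End Covers.
(** * Sets offered to a selector *)

Definition harmonic (n : nat) : R := \rsum_(r < n) / INR r.+1.

Section Offers.
Variables (D : finType) (f : {set D} -> D).
Hypothesis f_mem : forall S : {set D}, S != set0 -> f S \in S.

(** The sets met when the elements selected by [f] are removed one after the
    other have all the sizes from [#|S|] down to [1]; this is the one from which
    [x] is selected. The fuel [n] is [#|S|]. *)
Fixpoint offer (n : nat) (S : {set D}) (x : D) : {set D} :=
  if n is n'.+1 then if f S == x then S else offer n' (S :\ f S) x else S.

Lemma card_remove_selected n (S : {set D}) :
  #|S| = n.+1 -> f S \in S /\ #|S :\ f S| = n.
Proof.
move=> Sn; have fS : f S \in S by apply: f_mem; rewrite -card_gt0 Sn.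
by split=> //; apply/eqP; rewrite -eqSS -Sn (cardsD1 (f S) S) fS.
Qed.

Lemma offer_selects n (S : {set D}) x :
  #|S| = n -> x \in S -> f (offer n S x) = x.
Proof.
elim: n S => [|n IH] S Sn xS; first by rewrite (cards0_eq Sn) inE in xS.
have [_ S'n] := card_remove_selected Sn.
rewrite /=; case: (f S =P x) => // fx; apply: IH => //.
by rewrite !inE xS andbT; apply/eqP => E; apply: fx.
Qed.

Lemma offer_neq0 n (S : {set D}) x :
  #|S| = n -> x \in S -> offer n S x != set0.
Proof.
elim: n S => [|n IH] S Sn xS; first by rewrite (cards0_eq Sn) inE in xS.
have [_ S'n] := card_remove_selected Sn.
rewrite /=; case: (f S =P x) => [_|fx]; first by rewrite -card_gt0 Sn.
by apply: IH; rewrite // !inE xS andbT; apply/eqP => E; apply: fx.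
Qed.

Lemma sum_inv_card_offer n (S : {set D}) : #|S| = n ->
  \rsum_(x in S) (/ INR #|offer n S x|) = harmonic n.
Proof.
rewrite /harmonic; elim: n S => [|n IH] S Sn.
  by rewrite (cards0_eq Sn) big_set0 big_ord0.
have [fS S'n] := card_remove_selected Sn.
rewrite (big_setD1 _ fS) /= eqxx Sn -[LHS]/(_ + _) Rplus_comm.
rewrite big_ord_recr; congr (_ + _); rewrite -(IH _ S'n).
by apply: eq_bigr => x; rewrite !inE eq_sym => /andP[/negPf -> _].
Qed.

End Offers.

Lemma harmonic_pow2 n : harmonic (2 ^ n) <= INR n + 1.
Proof.
elim: n => [|n IH].
  by rewrite /harmonic expn0 big_ord_recr big_ord0 /=; lra.
have p : 0 < INR (2 ^ n) by apply: lt_0_INR; apply/ltP; rewrite expn_gt0.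
have -> : (2 ^ n.+1 = 2 ^ n + 2 ^ n)%N by rewrite expnS mul2n addnn.
have h m : harmonic (2 ^ n + m) <= harmonic (2 ^ n) + INR m * / INR (2 ^ n).
  elim: m => [|m IHm]; first by rewrite addn0 /=; lra.
  rewrite addnS {1}/harmonic big_ord_recr.
  apply: Rle_trans (Rplus_le_compat_r _ _ _ IHm) _.
  have h1 : / INR (2 ^ n + m).+1 <= / INR (2 ^ n).
    apply: Rinv_le_contravar => //; apply: le_INR; apply/leP.
    by rewrite leqW // leq_addr.
  apply: Rle_trans (Rplus_le_compat_l _ _ _ h1) _.
  by rewrite [INR m.+1]S_INR; lra.
have := h (2 ^ n)%N; rewrite Rinv_r; last lra.
by rewrite S_INR; lra.
Qed.

(** The harmonic sum over the [b.+1 ^ d] digits is logarithmic in the base, so a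
    large base makes its contribution to the exponent as small as desired. *)
Lemma exists_base (d : nat) (eta : R) : 0 < eta ->
  exists b, 1 < base b /\ 2 * harmonic (b.+1 ^ d) <= Rpower (base b) eta.
Proof.
move=> eta0; set x := Rpower 2 eta.
have x1 : 1 < x by rewrite -(Rpower_O 2); [apply: Rpower_lt; lra | lra].
set h := x - 1.
have hp : 0 < h by rewrite /h; lra.
have [n hn] := INR_unbounded ((4 * INR d + 2) / (h * h)).
pose j := (2 * n.+1)%N.
have bE : (2 ^ j).-1.+1 = (2 ^ j)%N by rewrite prednK // expn_gt0.
exists (2 ^ j).-1.
have BE : base (2 ^ j).-1 = 2 ^ j.
  by rewrite /base bE; elim: j {bE} => [|k IH] //=; rewrite expnS INR_muln IH.
rewrite BE bE -expnM; split; first by apply: Rlt_pow_R1; [lra | apply/ltP].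
rewrite Rpower_pow_comm -/x; last lra.
apply: Rle_trans (Rmult_le_compat_l 2 _ _ _ (harmonic_pow2 _)) _; first lra.
rewrite INR_muln /j INR_muln.
have -> : x ^ (2 * n.+1) = x ^ n.+1 * x ^ n.+1.
  by rewrite mul2n -addnn pow_add.
have := poly n.+1 h hp; have -> : 1 + h = x by rewrite /h; lra.
have n0 := pos_INR n; have d0 := pos_INR d; rewrite S_INR.
move=> hx; set N := INR n + 1 in hx *.
have h2 : 4 * INR d + 2 <= N * (h * h).
  apply: (@Rle_trans _ ((4 * INR d + 2) / (h * h) * (h * h))).
    by apply: Req_le; field; lra.
  by apply: Rmult_le_compat_r; [nra | rewrite /N; lra].
have h3 : (N * h) * (N * h) <= x ^ n.+1 * x ^ n.+1.
  have Nh : 0 <= N * h by rewrite /N; nra.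
  by apply: Rmult_le_compat; lra.
apply: Rle_trans h3; rewrite (_ : INR 2 = 2) //.
have N1 : 1 <= N by rewrite /N; lra.
have : N * (4 * INR d + 2) <= N * (N * (h * h)).
  by apply: Rmult_le_compat_l; lra.
by nra.
Qed.

(** * Plays *)

Lemma prefixS x n : prefix x n.+1 = prefix x n ++ [:: x n].
Proof. by rewrite /prefix List.seq_S List.map_app. Qed.

Section Plays.
Variables (D : Type) (moves : seq nat -> D -> nat * nat).

(** A play against a strategy is steered by the free choices of the opponent, one
    element of [D] in each round; [moves] turns the position and this element
    into the two moves of the round. *)
Definition position (q : seq D) : seq nat :=
  foldl (fun p z => p ++ [:: (moves p z).1; (moves p z).2]) [::] q.

Definition play (a : nat -> D) (n : nat) : nat :=
  let m := moves (position (mkseq a n./2)) (a n./2) in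
  if odd n then m.2 else m.1.

Lemma play_even a n : play a (2 * n) = (moves (position (mkseq a n)) (a n)).1.
Proof. by rewrite /play mul2n doubleK odd_double. Qed.

Lemma play_odd a n :
  play a (2 * n + 1) = (moves (position (mkseq a n)) (a n)).2.
Proof. by rewrite /play mul2n addn1 /= odd_double uphalf_double. Qed.

Lemma prefix_play a n : prefix (play a) (2 * n) = position (mkseq a n).
Proof.
elim: n => [|n IH] //.
rewrite mulnS add2n !prefixS IH play_even -[(2 * n).+1]addn1 play_odd.
by rewrite mkseqS /position foldl_rcons -catA.
Qed.

End Plays.

Lemma nodeprod_mkseq_eq (D : finType) (p p' : seq D -> D -> R) a a' m :
  (forall j, p (mkseq a j) (a j) = p' (mkseq a' j) (a' j)) ->
  nodeprod p (mkseq a m) = nodeprod p' (mkseq a' m).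
Proof.
move=> E; elim: m => [//|m IH].
by rewrite !mkseqS !nodeprod_rcons IH E.
Qed.

(** * The game *)

Section Game.
Variables (d b : nat) (delta s : R) (A : point d -> Prop).
Notation digit := (digit d b).
Notation base := (base b).
Notation threshold := (threshold d s).

Definition select (D : finType) (S : {set D}) (x : D) : D :=
  if x \in S then x else odflt x [pick z in S].

Lemma select_mem (D : finType) (S : {set D}) x : S != set0 -> select S x \in S.
Proof.
move=> /set0Pn [z zS]; rewrite /select; case: ifP => // _.
by case: pickP => [//|/(_ z)]; rewrite zS.
Qed.

Definition decode_I (n : nat) : nat * {set digit} :=
  odflt (0%N, set0) (unpickle n).

Definition decode_II (n : nat) : digit := odflt [ffun=> ord0] (unpickle n).

Definition offered (x : nat -> nat) (j : nat) : {set digit} :=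
  (decode_I (x (2 * j)%N)).2.

Definition address (x : nat -> nat) (j : nat) : digit :=
  select (offered x j) (decode_II (x (2 * j + 1)%N)).

(** The very first move names the initial cube, and every move of the first player
    offers a set. Moves of the second player outside the offered set are corrected
    by [select], so there are no illegal moves for the payoff to penalize. *)
Definition payoff (x : nat -> nat) : Prop :=
  let k := (decode_I (x 0%N)).1 in
  (forall m, threshold k * Rpower base delta ^ m <=
     nodeprod (fun q _ => INR #|offered x (size q)|) (mkseq (address x) m)) /\
  exists y, A y /\ forall m, cell (side k) (mkseq (address x) m) y.

Hypothesis b_gt1 : 1 < base.

Lemma threshold_gt0 k : 0 < threshold k.
Proof.
apply: Rdiv_lt_0_compat; first by apply: pow_lt; lra.
exact: exp_pos.
Qed.

(** The tree is that of the replies to all the sequences of selections. *)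
Lemma compact_of_winning_I sigma : winning_I payoff sigma ->
  exists K, subset K A /\ compact_set K /\ Rbar_le (Finite delta) (HD K).
Proof.
move=> win.
pose moves p (z : digit) := (sigma p, pickle z).
pose S q := (decode_I (sigma (position moves q))).2.
pose k := (decode_I (sigma [::])).1.
have pay a : payoff (play moves a).
  apply: win => n; have := prefix_play moves a n => E.
  by rewrite -[(2 * n)%coq_nat]/(2 * n)%N E play_even.
have kE a : (decode_I (play moves a 0)).1 = k by [].
have offE a j : offered (play moves a) j = S (mkseq a j).
  by rewrite /offered play_even.
have adrE a j : address (play moves a) j = select (S (mkseq a j)) (a j).
  by rewrite /address offE play_odd /decode_II pickleK.
apply: (@compact_of_tree d b (side k) (threshold k) delta A S b_gt1).
- exact: side_gt0.
- exact: threshold_gt0.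
- move=> q; pose a := nth ([ffun=> ord0] : digit) q.
  have [h _] := pay a; have := h (size q); rewrite kE.
  rewrite (@nodeprod_mkseq_eq _ _ (fun q _ => INR #|S q|) _ a).
    by rewrite /a mkseq_nth.
  by move=> j; rewrite size_mkseq offE.
- move=> a la; have [_ [y [Ay cy]]] := pay a; exists y; split=> // m.
  have := cy m; rewrite kE (@eq_mkseq _ _ a) // => j.
  by rewrite adrE /select la.
Qed.

Lemma exists_address (side0 : R) y : cell side0 ([::] : seq digit) y ->
  exists a : nat -> digit, forall m, cell side0 (mkseq a m) y.
Proof.
move=> c0.
pose next (q : seq digit) := odflt ([ffun=> ord0] : digit)
  [pick x | holds (cell side0 (rcons q x) y)].
have nextP q : cell side0 q y -> cell side0 (rcons q (next q)) y.
  move=> /cell_child [x hx]; rewrite /next.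
  by case: pickP => [z /holdsP|/(_ x) /holdsP].
exists (branch next) => m; rewrite mkseq_branch.
by elim: m => [|m IH] //=; apply: nextP.
Qed.

Hypotheses (d_gt0 : (0 < d)%N) (s_gt0 : 0 < s) (delta_s : delta <= s).
Hypothesis b_large :
  2 * harmonic (b.+1 ^ d) * Rpower base delta <= Rpower base s.

(** Each digit of the address of a point of [A] is offered in the set from which
    [tau] selects it, so the play follows the address; as it is lost, the product
    of the sizes falls below the threshold. *)
Lemma null_of_winning_II tau : winning_II payoff tau ->
  hausdorff_measure s A = Finite 0.
Proof.
move=> win.
pose choice (k : nat) p (S : {set digit}) :=
  select S (decode_II (tau (p ++ [:: pickle (k, S)]))).
pose bid k p (z : digit) := offer (choice k p) #|[set: digit]| setT z.
have choice_mem k p S : S != set0 -> choice k p S \in S by apply: select_mem.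
pose moves k p (z : digit) :=
  let u := pickle (k, bid k p z) in (u, tau (p ++ [:: u])).
pose e k (q : seq digit) z := bid k (position (moves k) q) z.
apply: (@null_of_rejected d b delta s A e (harmonic (b.+1 ^ d))) => //.
- move=> k q x; rewrite card_gt0.
  by apply: (offer_neq0 (choice_mem k _)); rewrite ?inE.
- move=> k q; apply: Req_le.
  rewrite (eq_bigl (fun x => x \in [set: digit])); last first.
    by move=> x; rewrite in_setT.
  rewrite (sum_inv_card_offer (choice_mem k _)) //.
  by rewrite cardsT card_ffun !card_ord.
- move=> k y Ay /exists_address [a ha].
  set x := play (moves k) a.
  have offE j : offered x j = e k (mkseq a j) (a j).
    by rewrite /offered /x play_even /decode_I pickleK.
  have kE : (decode_I (x 0%N)).1 = k by rewrite /decode_I /x /play /= pickleK.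
  have adrE j : address x j = a j.
    rewrite /address offE /x play_odd /=.
    by apply: (offer_selects (choice_mem k _)); rewrite ?inE.
  have nP : ~ payoff x.
    apply: win => n; rewrite -[(2 * n + 1)%coq_nat]/(2 * n + 1)%N.
    by rewrite /x play_odd addn1 prefixS prefix_play play_even.
  apply: NNPP => nq; apply: nP; rewrite /payoff kE; split=> [m|].
    rewrite (@nodeprod_mkseq_eq _ _ (fun q x => INR #|e k q x|) _ a).
      apply: Rnot_lt_le => lt; apply: nq; exists (mkseq a m).
      by rewrite size_mkseq.
    by move=> j; rewrite size_mkseq offE.
  exists y; split=> // m.
  by rewrite (@eq_mkseq _ _ a).
Qed.

End Game.

Theorem corollary1 :
  AD ->
  forall (d : nat), (1 <= d)%coq_nat ->
  forall (A : point d -> Prop) (delta : R), 0 <= delta <= INR d ->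
    (exists K : point d -> Prop,
        subset K A /\ compact_set K /\ Rbar_le (Finite delta) (HD K)) \/
    Rbar_le (HD A) (Finite delta).
Proof.
move=> ad d /leP d1 A delta [delta0 _].
case: (classic (exists K, subset K A /\ compact_set K /\
  Rbar_le (Finite delta) (HD K))) => [|nK]; first by left.
right.
have null s : delta < s -> hausdorff_measure s A = Finite 0.
  move=> ds; have [|b [b1 bs]] := @exists_base d (s - delta); first lra.
  case: (ad (@payoff d b delta s A)) => [[sigma win]|[tau win]].
    by case: nK; apply: compact_of_winning_I win.
  apply: null_of_winning_II win => //; try lra.
  have -> : Rpower (base b) s
      = Rpower (base b) (s - delta) * Rpower (base b) delta.
    by rewrite -Rpower_plus; congr Rpower; lra.
  by apply: Rmult_le_compat_r bs; apply: Rlt_le; apply: exp_pos.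
have lb s : delta < s -> Rbar_le (HD A) s.
  by move=> ds; apply: (proj1 (Glb_Rbar_correct _)); split; [lra | apply: null].
have := lb (delta + 1) ltac:(lra).
case: (HD A) lb => [h||] //= lb _.
apply: Rnot_lt_le => lt.
by have := lb ((h + delta) / 2) ltac:(lra); lra.
Qed.
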